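(* Let $f,g:\mathbb{R}\to\mathbb{R}$ be locally Lipschitz and suppose that for every $p>0$ there are positive constants $K=K_p$ and $K_1=K_{1,p}$, depending only on $p$, such that for all $y\in\mathbb{R}$ $$yf(y)+\frac{p-1}{2}g^2(y)\le K,\qquad e^{2y}\Big[f(y)+\frac p2g^2(y)\Big]\le K_1(1+e^{2y}).$$ Then the truncated Euler--Maruyama approximation $y_\Delta(t)$ (defined in the context) for $\mathrm{d}y=f(y)\mathrm{d}t+g(y)\mathrm{d}W$, $y(0)=y_0$, satisfies, for every $p>0$, $$\sup_{\Delta\in(0,1]}\ \sup_{t\in[0,T]}\mathbb{E}\,e^{p\,y_\Delta(t)}<\infty .$$
   Context: $T>0$ is fixed, $W$ is a one-dimensional Brownian motion, $y_0\in\mathbb{R}$ is deterministic. Step sizes are $\Delta=T/N\in(0,1]$ with $N$ a positive integer, $t_k=k\Delta$. Truncation: $\psi:[1,\infty)\to(0,\infty)$ is strictly increasing with $\psi(R)\to+\infty$ as $R\to\infty$, with increasing inverse $\psi^{-1}$ defined on $[\psi(1),\infty)$, and $\sup_{|y|\le R}(|f(y)|\vee|g(y)|)\le\psi(R)$ for all $R\ge1$. The function $h:(0,1]\to[\psi(1),\infty)$ is strictly decreasing with $\lim_{\Delta\to0}h(\Delta)=+\infty$ and $\Delta^{1/4}h(\Delta)\le c_0$ for all $\Delta\in(0,1]$, where $c_0\ge1\vee\psi(1)$ is a constant. Define $$f_\Delta(x)=f\Big(\big(|x|\wedge\psi^{-1}(h(\Delta))\big)\frac{x}{|x|}\Big),\qquad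 g_\Delta(x)=g\Big(\big(|x|\wedge\psi^{-1}(h(\Delta))\big)\frac{x}{|x|}\Big),$$ with $x/|x|:=0$ for $x=0$. Truncated Euler--Maruyama approximation: $y_\Delta(0)=y_0$, $y_\Delta(t_{k+1})=y_\Delta(t_k)+\Delta f_\Delta(y_\Delta(t_k))+g_\Delta(y_\Delta(t_k))(W(t_{k+1})-W(t_k))$, extended to continuous time by $$y_\Delta(t)=y_0+\int_0^tf_\Delta(\bar y_\Delta(s))\mathrm{d}s+\int_0^tg_\Delta(\bar y_\Delta(s))\mathrm{d}W(s),\qquad \bar y_\Delta(t)=y_\Delta(t_k)\ \text{for }t\in[t_k,t_{k+1}).$$ *)

(* Defs.v *)
From HB Require Import structures.
From mathcomp Require Import all_boot all_order all_algebra.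
From mathcomp Require Import all_classical all_reals all_analysis.

Set Implicit Arguments.
Unset Strict Implicit.
Unset Printing Implicit Defensive.

Import Order.TTheory GRing.Theory Num.Theory.
Import numFieldNormedType.Exports.

Local Open Scope classical_set_scope.
Local Open Scope ring_scope.

(* As each [B i] may be [setT], the product rule over all of [I] entails the
   product rule over every subfamily. *)
Definition mutually_independent (d : measure_display) (Omega : measurableType d)
    (R : realType) (P : probability Omega R) (I : finType)
    (X : I -> Omega -> R) : Prop :=
  forall B : I -> set R, (forall i, measurable (B i)) ->
    (P (\bigcap_i (X i @^-1` B i)) = \prod_(i : I) P (X i @^-1` B i))%E.

(* Only the values [W t] with [0 <= t] are meaningful. *)
Record brownian_motion (d : measure_display) (Omega : measurableType d)
    (R : realType) (P : probability Omega R) (W : R -> {RV P >-> R}) : Prop :=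
  BrownianMotion {
    bm_start : {ae P, forall w, W 0 w = 0} ;
    bm_independent : forall (n : nat) (t : nat -> R), 0 <= t 0%N ->
      (forall i, (i < n)%N -> t i < t i.+1) ->
      mutually_independent P
        (fun (i : 'I_n) (w : Omega) => W (t i.+1) w - W (t i) w) ;
    (* the second parameter of [normal_prob] is the standard deviation *)
    bm_gaussian : forall s t : R, 0 <= s -> s < t ->
      forall A : set R, measurable A ->
      P ((fun w => W t w - W s w) @^-1` A) = normal_prob 0 (Num.sqrt (t - s)) A ;
    bm_continuous :
      {ae P, forall w, {within `[0, +oo[, continuous (fun t : R => W t w)}} }.

Definition locally_lipschitz (R : realType) (f : R -> R) : Prop :=
  forall r : R, 0 < r -> [lipschitz f x | x in `[- r, r]].

(* [psi] only matters on [1, +oo[, [psi_inv] on [psi 1, +oo[ and [h] on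
   ]0, 1].  That [psi_inv] is increasing follows from [tr_psi_incr] and the
   two inverse laws. *)
Record truncation (R : realType) (f g psi psi_inv h : R -> R) (c0 : R) : Prop :=
  Truncation {
    tr_psi_gt0 : forall r, 1 <= r -> 0 < psi r ;
    tr_psi_incr : forall r s, 1 <= r -> r < s -> psi r < psi s ;
    tr_psi_infty : psi r @[r --> +oo] --> +oo ;
    tr_psi_inv_ge1 : forall u, psi 1 <= u -> 1 <= psi_inv u ;
    tr_psi_invK : forall u, psi 1 <= u -> psi (psi_inv u) = u ;
    tr_psiK : forall r, 1 <= r -> psi_inv (psi r) = r ;
    tr_bound : forall r y, 1 <= r -> `|y| <= r ->
      Num.max `|f y| `|g y| <= psi r ;
    tr_h_ge : forall D : R, 0 < D <= 1 -> psi 1 <= h D ;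
    tr_h_decr : forall D E : R, 0 < D -> D < E -> E <= 1 -> h E < h D ;
    tr_h_infty : h D @[D --> 0^'+] --> +oo ;
    tr_c0 : Num.max 1 (psi 1) <= c0 ;
    tr_h_growth : forall D : R, 0 < D <= 1 -> D `^ (1 / 4) * h D <= c0 }.

(* [x / `|x|] is [0] at [x = 0], as required. *)
Definition clip (R : realType) (r x : R) : R :=
  Num.min `|x| r * (x / `|x|).

(* [truncated psi_inv h D f] is $f_\Delta$. *)
Definition truncated (R : realType) (psi_inv h : R -> R) (D : R) (f : R -> R)
    (x : R) : R :=
  f (clip (psi_inv (h D)) x).

Definition step_sizes (R : realType) (T : R) : set R :=
  [set D | D <= 1 /\ exists2 N : nat, (0 < N)%N & D = T / N%:R].

(* The Ito integral over [0, t] of the elementary process equal to [G k] on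
   [k D, (k+1) D[; the intervals starting after [t] contribute nothing. *)
Definition elementary_ito (R : realType) (Omega : Type) (W : R -> Omega -> R)
    (D : R) (G : nat -> Omega -> R) (t : R) (w : Omega) : R :=
  \sum_(k < (Num.truncn (t / D)).+1)
    G k w * (W (Num.min (k.+1%:R * D) t) w - W (Num.min (k%:R * D) t) w).

Section EulerMaruyama.
Variables (R : realType) (Omega : Type) (W : R -> Omega -> R).
Variables (a b : R -> R) (y0 D : R).

Fixpoint em_grid (k : nat) (w : Omega) : R :=
  if k is j.+1 then
    em_grid j w + D * a (em_grid j w)
      + b (em_grid j w) * (W (j.+1%:R * D) w - W (j%:R * D) w)
  else y0.

Definition em_step (t : R) (w : Omega) : R := em_grid (Num.truncn (t / D)) w.

Definition em_cont (t : R) (w : Omega) : R :=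
  y0 + \int[lebesgue_measure]_(s in `[0, t]) a (em_step s w)
     + elementary_ito W D (fun k w' => b (em_grid k w')) t w.

End EulerMaruyama.

Definition truncated_em (R : realType) (Omega : Type) (W : R -> Omega -> R)
    (f g psi_inv h : R -> R) (y0 D : R) : R -> Omega -> R :=
  em_cont W (truncated psi_inv h D f) (truncated psi_inv h D g) y0 D.

(* Main.v *)
Require Import Defs.
From HB Require Import structures.
From mathcomp Require Import all_boot all_order all_algebra.
From mathcomp Require Import all_classical all_reals all_analysis.
From mathcomp Require Import measurable_realfun.
From mathcomp Require Import ring lra.
Import Order.TTheory GRing.Theory Num.Theory.
Import numFieldNormedType.Exports.
Local Open Scope classical_set_scope.
Local Open Scope ring_scope.
Set Implicit Arguments.
Unset Strict Implicit.
Unset Printing Implicit Defensive.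

(** Conditionally on the value [x] at a grid point, the approximation at a time
    [s] later, [s <= D], is [x + s * a + b * Z], where [a] and [b] are the
    truncated coefficients at [x] and [Z] is a centred Gaussian of variance
    [s] independent of [x].  Hence its conditional [p]-th exponential moment
    is exactly [expR (p * x + u)], with
    [u = p * s * (a + p / 2 * b ^+ 2)], and everything reduces to a pointwise
    inequality in [x] ([truncated_exponential_step]):

      [expR (p * x + u) + 1 <= expR (C * s) * (expR (p * x) + 1)],

    where [C] does not depend on [D].  Two bounds on [u] give it.  The growth
    condition on [h] makes [D * h D] and [D * h D ^+ 2] bounded, so that [u] is
    at most a constant and [expR u - 1] is controlled linearly by any
    nonnegative upper bound of [u].  The exponential drift condition provides
    such a bound, [p * s * K1 * (1 + expR (- 2 * y))], with [y] the truncation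
    of [x].  Its second term is large when [x] is very negative, but then
    [x <= y] and the weight [expR (p * x)] absorbs it as soon as [2 <= p]
    ([expR_clip_moment]).

    Along the grid the factors [expR (C * D)] multiply to at most
    [expR (C * t)], hence a bound on [\int (expR (p * y_D t) + 1)] which is
    uniform in [D] and in [t <= T].  Exponents [p < 2] follow from
    [expR (p * y) <= expR (2 * y) + 1].

    The passage from conditional to plain expectations is Fubini's theorem
    ([integral_independent]).  It needs a grid value to be independent of the
    next Brownian increment, which a pi-lambda argument extracts from the
    product rule for finitely many increments ([independent_others]). *)

(** * Gaussian exponential moments *)

(** Density formula: [normal_pdf] and the Radon-Nikodym derivative of
    [normal_prob] agree almost everywhere, having the same integrals. *)
Lemma integral_normal_prob (R : realType) (m s : R) (F : R -> \bar R) :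
    measurable_fun setT F -> (forall x, 0 <= F x)%E ->
  (\int[normal_prob m s]_x F x =
   \int[lebesgue_measure]_x (F x * (normal_pdf m s x)%:E))%E.
Proof.
move=> mF F0; have dom := normal_prob_dominates m s.
rewrite -(Radon_Nikodym_SigmaFinite.change_of_variables dom)//.
have mRN := measurable_int _ (Radon_Nikodym_SigmaFinite.f_integrable dom).
have mpdf : measurable_fun setT (fun x : R => (normal_pdf m s x)%:E).
  by apply/measurable_EFinP; exact: measurable_normal_pdf.
apply: ae_eq_integral => //.
- exact: emeasurable_funM.
- exact: emeasurable_funM.
- apply: ae_eqe_mul2l; apply: integral_ae_eq => //.
    exact: Radon_Nikodym_SigmaFinite.f_integrable.
  by move=> E _ mE; rewrite -Radon_Nikodym_SigmaFinite.f_integral.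
Qed.

(** Completing the square turns the tilted centred density into a multiple of
    the density with mean [a * s ^+ 2]. *)
Lemma normal_mgf (R : realType) (s a : R) : s != 0 ->
  (\int[normal_prob 0 s]_z (expR (a * z))%:E =
   (expR (a ^+ 2 * s ^+ 2 / 2))%:E)%E.
Proof.
move=> s0; rewrite integral_normal_prob; last 2 first.
- apply/measurable_EFinP.
  by apply: measurableT_comp.
- by move=> z; rewrite lee_fin expR_ge0.
under eq_integral => z _.
  have -> : ((expR (a * z))%:E * (normal_pdf 0 s z)%:E =
      (expR (a ^+ 2 * s ^+ 2 / 2))%:E * (normal_pdf (a * s ^+ 2) s z)%:E)%E.
    rewrite -!EFinM !normal_pdfE//; congr EFin.
    suff -> : expR (a ^+ 2 * s ^+ 2 / 2) * (normal_peak s *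
        normal_fun (a * s ^+ 2) s z) = normal_peak s *
        (expR (a * z) * normal_fun 0 s z) by ring.
    rewrite [LHS](_ : _ = normal_peak s * (expR (a ^+ 2 * s ^+ 2 / 2) *
      normal_fun (a * s ^+ 2) s z)); last by ring.
    by rewrite /normal_fun -!expRD; congr (_ * expR _); field.
  over.
rewrite ge0_integralZl//.
- by rewrite integral_normal_pdf mule1.
- by apply/measurable_EFinP; exact: measurable_normal_pdf.
- by move=> z _; rewrite lee_fin normal_pdf_ge0.

Qed.


Lemma normal_affine_mgf (R : realType) (s a b : R) : s != 0 ->
  (\int[normal_prob 0 s]_z (expR (a + b * z) + 1)%:E =
   (expR (a + b ^+ 2 * s ^+ 2 / 2) + 1)%:E)%E.
Proof.
move=> s0; have mexp c : measurable_fun setT (fun z : R => (expR (c * z))%:E).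
  apply/measurable_EFinP.
  by apply: measurableT_comp => //; exact: mulrl_measurable.
under eq_integral do rewrite expRD EFinD EFinM.
rewrite ge0_integralD//; last first.
  by apply: emeasurable_funM => //; exact: mexp.
have -> : (\int[normal_prob 0 s]__ 1 = 1)%E.
  by rewrite integral_cst//= probability_setT mule1.
rewrite ge0_integralZl//; last exact: mexp.
by rewrite normal_mgf// -EFinM -EFinD expRD.
Qed.

(** * Independence and iterated integration *)

(** The cylinder events that leave the coordinate [i0] free: a pi-system
    generating the sigma-algebra of the other coordinates. *)
Definition others_events (T : Type) (R : realType) (I : finType)
    (X : I -> T -> R) (i0 : I) : set_system T :=
  [set E | exists B : I -> set R, [/\ forall i, measurable (B i),
     B i0 = setT & E = \bigcap_i (X i @^-1` B i)]].

Section independence.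
Context (d : measure_display) (Omega : measurableType d) (R : realType).
Variables (P : probability Omega R) (I : finType) (X : I -> Omega -> R).
Hypothesis mX : forall i, measurable_fun setT (X i).

Let mXB i B : measurable B -> measurable (X i @^-1` B).
Proof. by move=> mB; rewrite -[_ @^-1` _]setTI; exact: mX. Qed.

Lemma others_events_measurable i0 :
  <<s others_events X i0 >> `<=` @measurable _ Omega.
Proof.
apply: smallest_sub; first exact: sigma_algebra_measurable.
move=> _ [B [mB _ ->]]; apply: fin_bigcap_measurable => // i _.
exact: mXB.
Qed.

Lemma others_events_setI i0 : setI_closed (others_events X i0).
Proof.
move=> _ _ [B [mB B0 ->]] [C [mC C0 ->]]; exists (fun i => B i `&` C i); split.
- by move=> i; exact: measurableI.
- by rewrite B0 C0 setIT.
- by rewrite -bigcapI; apply: eq_bigcapr => i _; rewrite preimage_setI.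
Qed.

Lemma others_measurable i0 i : i != i0 ->
  measurable_fun [set: g_sigma_algebraType (others_events X i0)] (X i).
Proof.
move=> ii0 _ B mB; rewrite setTI; apply: sub_sigma_algebra.
exists (fun j => if j == i then B else setT); split.
- by move=> j; case: ifP.
- by rewrite eq_sym (negbTE ii0).
- apply/seteqP; split=> [w Bw j _ | w /(_ i Logic.I)]; rewrite /preimage /=.
    by case: eqP => // ->.
  by rewrite eqxx.
Qed.

(** The product rule gives the identity on cylinder events, and for a fixed
    [B] the events [E] satisfying it form a Dynkin class. *)
Lemma independent_others (i0 : I) (E : set Omega) (B : set R) :
    mutually_independent P X -> <<s others_events X i0 >> E -> measurable B ->
  (P (E `&` X i0 @^-1` B) = P E * P (X i0 @^-1` B))%E.
Proof.
move=> indX GE mB; set F := X i0 @^-1` B.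
have mF : measurable F by exact: mXB.
pose T := g_sigma_algebraType (others_events X i0).
have mT (S : set T) : measurable S -> measurable (S : set Omega).
  exact: others_events_measurable.
have [pE pF] : P E \is a fin_num /\ P F \is a fin_num.
  by split; apply: fin_num_measure => //; exact: mT.
pose Q : set_system Omega := fun S => (P (S `&` F) = P S * P F)%E.
have QC S : measurable S -> Q S -> Q (~` S).
  rewrite /Q => mS QS.
  have -> : (P (~` S `&` F) = P F - P (S `&` F))%E.
    rewrite [~` S `&` F]setIC -setDE measureD ?[F `&` S]setIC//.
    by rewrite ltey_eq pF.
  have pS : P S \is a fin_num by exact: fin_num_measure.
  rewrite QS probability_setC// -(fineK pS) -(fineK pF) -!EFinM -!EFinB.
  by congr EFin; ring.
have QU (S : (set Omega)^nat) : (forall n, measurable (S n)) ->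
    trivIset setT S -> (forall n, Q (S n)) -> Q (\bigcup_n S n).
  rewrite /Q => mS tS QS.
  have -> : P (\bigcup_n S n) = (\sum_(n <oo) P (S n))%E.
    by rewrite measure_bigcup//; apply: eq_eseriesl => n; rewrite in_setT.
  have -> : P ((\bigcup_n S n) `&` F) = (\sum_(n <oo) P (S n `&` F))%E.
    rewrite setI_bigcupl measure_bigcup//.
    - by apply: eq_eseriesl => n; rewrite in_setT.
    - by move=> n _; exact: measurableI.
    - exact: trivIset_setIr.
  rewrite muleC -(fineK pF) -nneseriesZl//.
  by apply: eq_eseriesr => n _; rewrite QS muleC fineK.
suff: Q E by [].
apply: (@dynkin_induction _ T (others_events X i0) Q) => //.
- exact: others_events_setI.
- by rewrite /Q setTI probability_setT mul1e.
- move=> _ [C [mC C0 ->]]; rewrite /Q.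
  pose C' i := if i == i0 then B else C i.
  have mC' i : measurable (C' i) by rewrite /C'; case: ifP.
  have -> : (\bigcap_i (X i @^-1` C i)) `&` F = \bigcap_i (X i @^-1` C' i).
    apply/seteqP; split=> [w [Cw Fw] i _|w Cw].
      by rewrite /preimage /= /C'; case: eqP => [->//|_]; exact: Cw.
    split=> [i _|]; last by have := Cw i0 Logic.I; rewrite /preimage /= /C' eqxx.
    have := Cw i Logic.I; rewrite /preimage /= /C'; case: eqP => // ->.
    by rewrite C0.
  rewrite !indX// (bigD1 i0)//= [in RHS](bigD1 i0)//= C0 preimage_setT.
  rewrite probability_setT mul1e /C' eqxx muleC; congr (_ * _)%E.
  by apply: eq_bigr => i /negbTE ->.
- by move=> S /mT; exact: QC.
- by move=> S mS; apply: QU => n; exact: mT.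
Qed.
End independence.

(** The product rule says that the joint law of [X] and [Z] is a product
    measure, on which Tonelli's theorem applies. *)
Lemma integral_independent (d d1 d2 : measure_display)
    (Omega : measurableType d) (T1 : measurableType d1)
    (T2 : measurableType d2) (R : realType) (P : probability Omega R)
    (Q : probability T2 R) (X : Omega -> T1) (Z : Omega -> T2)
    (F : T1 * T2 -> \bar R) :
    measurable_fun setT X -> measurable_fun setT Z ->
    (forall A B, measurable A -> measurable B ->
      P (X @^-1` A `&` Z @^-1` B) = P (X @^-1` A) * Q B)%E ->
    measurable_fun setT F -> (forall v, 0 <= F v)%E ->
  (\int[P]_w F (X w, Z w) = \int[P]_w \int[Q]_z F (X w, z))%E.
Proof.
move=> mX mZ indXZ mF F0.
have mXZ := measurable_fun_pair mX mZ.
pose X' : {RV P >-> T1} := HB.pack X (isMeasurableFun.Build _ _ _ _ _ mX).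
pose XZ : {RV P >-> _} := HB.pack (fun w => (X w, Z w))
  (isMeasurableFun.Build _ _ _ _ _ mXZ).
transitivity (\int[distribution P XZ]_v F v)%E.
  by rewrite ge0_integral_distribution.
transitivity (\int[distribution P X' \x Q]_v F v)%E.
  apply: eq_measure_integral => A mA _; apply/esym.
  exact: product_measure_unique.
rewrite fubini_tonelli1// ge0_integral_distribution//.
- exact: measurable_fun_fubini_tonelli_F.
- by move=> x; exact: integral_ge0.
Qed.

(** * The one-step exponential inequality *)

Lemma clipE (R : realType) (r x : R) : 0 <= r ->
  clip r x = Num.max (- r) (Num.min x r).
Proof.
move=> r0; rewrite /clip; have [x0|x0|->] := ltgtP x 0.
- rewrite ltr0_norm// invrN mulrN divff ?lt_eqF// mulrN1 oppr_min opprK.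
  rewrite (min_l (le_trans (ltW x0) r0)) maxC//.
- rewrite gtr0_norm// divff ?gt_eqF// mulr1 max_r// le_min.
  by rewrite (le_trans _ (ltW x0)) ?oppr_le0//= -subr_ge0 opprK addr_ge0.
- by rewrite mul0r mulr0 min_l// max_r// oppr_le0.
Qed.

Lemma clip_norm (R : realType) (r x : R) : 0 <= r -> `|clip r x| <= r.
Proof.
move=> r0; rewrite clipE// ler_norml le_max lexx/= ge_max ge_min lexx orbT andbT.
by rewrite -subr_ge0 opprK addr_ge0.
Qed.

Lemma clip_ge (R : realType) (r x : R) : 0 <= r -> x <= 0 -> x <= clip r x.
Proof.
by move=> r0 x0; rewrite clipE// le_max (min_l (le_trans x0 r0)) lexx orbT.
Qed.

Lemma clip_ge0 (R : realType) (r x : R) : 0 <= r -> 0 <= x -> 0 <= clip r x.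
Proof. by move=> r0 x0; rewrite clipE// le_max le_min x0 r0 orbT. Qed.

(** For [0 <= x] the second factor is at most [2].  For [x < 0], [clip r x] is
    at least [x], so the mixed term is at most [expR ((p - 2) * x) <= 1]. *)
Lemma expR_clip_moment (R : realType) (p r x : R) : 0 <= r -> 2 <= p ->
  expR (p * x) * (1 + expR (- (2 * clip r x))) <= 2 * (expR (p * x) + 1).
Proof.
move=> r0 p2; have e0 := expR_gt0 (p * x).
have [x0|x0] := leP 0 x.
  have : expR (- (2 * clip r x)) <= 1.
    by rewrite expR_le1 oppr_le0 mulr_ge0// clip_ge0.
  by move=> ?; nra.
have le1 : expR (p * x) * expR (- (2 * clip r x)) <= 1.
  have := clip_ge r0 (ltW x0).
  by rewrite -expRD expR_le1 => ?; nra.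
by rewrite mulrDr mulr1; lra.
Qed.

(** Convexity gives [expR u - 1 <= u * expR u]; this linearises the increment
    of an exponential when [u] is bounded above. *)
Lemma expR_sub1_le (R : realType) (B u v : R) : u <= B -> u <= v -> 0 <= v ->
  expR u - 1 <= expR B * v.
Proof.
move=> uB uv v0; have [u0|u0] := leP u 0.
  have : expR u <= 1 by rewrite expR_le1.
  have : 0 <= expR B * v by rewrite mulr_ge0// expR_ge0.
  by lra.
have h1 : expR u - 1 <= expR u * u.
  have := expR_ge1Dx (- u); rewrite expRN => h.
  have e0 := expR_gt0 u.
  have : expR u * (1 - u) <= expR u * (expR u)^-1 by rewrite ler_pM2l.
  by rewrite divff ?gt_eqF//; lra.
apply: (le_trans h1); apply: ler_pM => //; first exact: ltW.
by rewrite ler_expR.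
Qed.

(** With [q = D `^ (1 / 4)] these are [q ^+ 3 * (q * m)] and
    [q ^+ 2 * (q * m) ^+ 2], and [q <= 1]. *)
Lemma coefficient_growth (R : realType) (c D m : R) : 0 < D <= 1 -> 0 <= m ->
  D `^ (1 / 4) * m <= c -> D * m <= c /\ D * m ^+ 2 <= c ^+ 2.
Proof.
move=> /andP[D0 D1] m0; set q := D `^ _ => qmc.
have q0 : 0 < q by exact: powR_gt0.
have q4 : q ^+ 4 = D.
  by rewrite -powR_mulrn ?ltW// -powRrM mul1r mulVf// powRr1// ltW.
have q1 : q <= 1.
  rewrite leNgt; apply/negP => q1.
  by have := exprn_egt1 4 q1; rewrite q4 ltNge D1.
have qm0 : 0 <= q * m by rewrite mulr_ge0// ltW.
split.
  apply: le_trans qmc; rewrite ler_wpM2r// -q4 exprSr ler_piMl ?(ltW q0)//.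
  by rewrite exprn_ile1// (ltW q0).
have -> : D * m ^+ 2 = q ^+ 2 * (q * m) ^+ 2 by rewrite -q4; ring.
apply: (@le_trans _ _ ((q * m) ^+ 2)).
  by rewrite ler_piMl ?sqr_ge0// exprn_ile1// (ltW q0).
by rewrite lerXn2r// nnegrE (le_trans qm0).
Qed.

Lemma truncated_bound (R : realType) (f g psi psi_inv h : R -> R) (c0 D x : R) :
    truncation f g psi psi_inv h c0 -> 0 < D <= 1 ->
  `|truncated psi_inv h D f x| <= h D /\ `|truncated psi_inv h D g x| <= h D.
Proof.
move=> tr D01; have hD := tr_h_ge tr D01.
have r1 := tr_psi_inv_ge1 tr hD.
have := tr_bound tr r1 (clip_norm x (le_trans ler01 r1)).
by rewrite ge_max (tr_psi_invK tr)// => /andP.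
Qed.

(** The exponent is the bound on [p * s * (a + p / 2 * b ^+ 2)] that follows
    from [s * `|a| <= c0] and [s * b ^+ 2 <= c0 ^+ 2]. *)
Definition growth_rate (R : realType) (p c0 K1 : R) : R :=
  2 * p * K1 * expR (p * (c0 + p / 2 * c0 ^+ 2)).

(** The one-step inequality.  Its left-hand side is the conditional expectation
    of [expR (p * _) + 1] after time [s]; adding [1] makes the recursion purely
    multiplicative. *)
Lemma truncated_exponential_step (R : realType) (f g psi psi_inv h : R -> R)
    (c0 p K1 D s x : R) :
    truncation f g psi psi_inv h c0 -> 2 <= p -> 0 <= K1 ->
    (forall y, expR (2 * y) * (f y + p / 2 * g y ^+ 2)
               <= K1 * (1 + expR (2 * y))) ->
    0 < D <= 1 -> 0 <= s <= D ->
  expR (p * (x + s * truncated psi_inv h D f x)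
        + p ^+ 2 * truncated psi_inv h D g x ^+ 2 * s / 2) + 1
    <= expR (growth_rate p c0 K1 * s) * (expR (p * x) + 1).
Proof.
move=> tr p2 K0 drift D01 /andP[s0 sD].
set a := truncated _ _ _ f x; set b := truncated _ _ _ g x.
have [D0 D1] := andP D01; have p0 : 0 <= p by lra.
have [aD bD] := truncated_bound x tr D01.
have hD0 : 0 <= h D.
  by rewrite (le_trans _ (tr_h_ge tr D01))// ltW// (tr_psi_gt0 tr).
have [Dh Dh2] := coefficient_growth D01 hD0 (tr_h_growth tr D01).
have r0 : 0 <= psi_inv (h D).
  by rewrite (le_trans _ (tr_psi_inv_ge1 tr (tr_h_ge tr D01))).
set y := clip (psi_inv (h D)) x.
(* the drift condition at [y], divided by [expR (2 * y)] *)
have drifty : a + p / 2 * b ^+ 2 <= K1 * (1 + expR (- (2 * y))).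
  have e0 := expR_gt0 (2 * y).
  rewrite -(ler_pM2l e0) (le_trans (drift y))//.
  have -> : expR (2 * y) * (K1 * (1 + expR (- (2 * y)))) =
      K1 * (expR (2 * y) * expR (- (2 * y)) + expR (2 * y)) by ring.
  by rewrite expRxMexpNx_1.
set u := p * s * (a + p / 2 * b ^+ 2).
have uB : u <= p * (c0 + p / 2 * c0 ^+ 2).
  rewrite /u -mulrA ler_wpM2l//.
  have sa : s * a <= c0.
    by apply: le_trans Dh; have := ler_norm a; nra.
  have sb : s * b ^+ 2 <= c0 ^+ 2.
    apply: le_trans Dh2; rewrite -[b ^+ 2]real_normK ?num_real//.
    by rewrite ler_pM ?sqr_ge0// lerXn2r// nnegrE.
  by rewrite mulrDr mulrCA; nra.
have e0 := expR_gt0 (- (2 * y)).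
have uv : u <= p * s * (K1 * (1 + expR (- (2 * y)))).
  by rewrite ler_wpM2l// mulr_ge0.
have v0 : 0 <= p * s * (K1 * (1 + expR (- (2 * y)))).
  by rewrite !mulr_ge0// addr_ge0// ltW.
have := expR_sub1_le uB uv v0; set B := expR (p * _) => stp.
have ex0 := expR_gt0 (p * x).
have -> : p * (x + s * a) + p ^+ 2 * b ^+ 2 * s / 2 = p * x + u.
  by rewrite /u; field.
apply: (@le_trans _ _ ((1 + growth_rate p c0 K1 * s) * (expR (p * x) + 1))).
  have B0 : 0 <= B by exact: expR_ge0.
  have m1 : expR (p * x) * (expR u - 1) <=
      expR (p * x) * (B * (p * s * (K1 * (1 + expR (- (2 * y)))))).
    by rewrite ler_pM2l.
  have m2 : (B * p * s * K1) * (expR (p * x) * (1 + expR (- (2 * y)))) <=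
      (B * p * s * K1) * (2 * (expR (p * x) + 1)).
    by rewrite ler_wpM2l ?expR_clip_moment// !mulr_ge0.
  have := lerD m1 m2; rewrite /growth_rate -/B expRD -!(subr_ge0 (_ + _)).
  by congr (is_true (0 <= _)); ring.
by rewrite ler_wpM2r ?expR_ge1Dx// addr_ge0// ltW.
Qed.

(** * Closed form of the continuous-time scheme *)

Section step_process.
Variable R : realType.
Notation mu := (@lebesgue_measure R).

(** The boolean [v] selects whether [t] is excluded, so that the lemma serves
    both for a full cell and for the last, closed one. *)
Lemma integral_append_constant (F : R -> R) (c u t : R) (v : bool) :
    0 <= u -> u <= t ->
    (forall s, [set` Interval (BLeft u) (BSide v t)] s -> F s = c) ->
    mu.-integrable [set` Interval (BLeft 0) (BSide v t)] (EFin \o F) ->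
  \int[mu]_(s in [set` Interval (BLeft 0) (BSide v t)]) F s =
    \int[mu]_(s in `[0, u[) F s + (t - u) * c.
Proof.
move=> u0 ut Fc.
rewrite (@itv_bndbnd_setU _ _ _ (BLeft u)); last 2 first.
- by rewrite bnd_simp.
- by case: v {Fc}; rewrite bnd_simp.
move=> iF; rewrite Rintegral_setU//; last first.
  rewrite disj_set2E; apply/eqP/seteqP; split => // s [] /=.
  rewrite !in_itv/= => /andP[_ su] /andP[us _].
  by have := lt_le_trans su us; rewrite ltxx.
congr (_ + _); rewrite (@eq_Rintegral _ _ _ mu _ (cst c)); last first.
  by move=> s /[!inE] /Fc.
rewrite Rintegral_cst//= lebesgue_measure_itv mulrC/= lte_fin.
case: ifPn => [//|]; rewrite -leNgt => tu.
have -> : t = u by apply/eqP; rewrite eq_le tu ut.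
by rewrite subrr.
Qed.

Lemma truncn_divE (D s : R) (j : nat) : 0 < D ->
  j%:R * D <= s < j.+1%:R * D -> Num.truncn (s / D) = j.
Proof.
by move=> D0 js; apply: truncn_def; rewrite ler_pdivlMr// ltr_pdivrMr.
Qed.

Lemma step_process_integrable (c : nat -> R) (D t : R) : 0 < D ->
  mu.-integrable `[0, t] (fun s => (c (Num.truncn (s / D)))%:E).
Proof.
move=> D0; pose k := Num.truncn (t / D).
pose I j : set R := `[j%:R * D, j.+1%:R * D[%classic.
(* up to time [t] only the cells with index at most [k] are visited *)
apply: (@eq_integrable _ _ _ mu _ _
  (fun s => \sum_(j <- iota 0 k.+1) (c j)%:E * (\1_(I j) s)%:E)%E) => //.
  move=> s /[!inE] /=; rewrite in_itv/= => /andP[s0 st].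
  have sD0 : 0 <= s / D by rewrite divr_ge0// ltW.
  have := truncn_itv sD0; set j := Num.truncn _ => /andP[js sj].
  have jk : j \in iota 0 k.+1.
    rewrite mem_iota add0n ltnS le_truncn// ler_wpM2r// invr_ge0; exact: ltW.
  rewrite (bigD1_seq _ jk (iota_uniq _ _))/=.
  rewrite big1 ?adde0.
    rewrite indicE mem_set ?mule1// /I /= in_itv/=.
    by rewrite -ler_pdivlMr// js -ltr_pdivrMr.
  move=> i ij; rewrite indicE memNset ?mule0// /I /= in_itv/= => si.
  by move: ij; rewrite /j (truncn_divE D0 si) eqxx.
apply: integrable_sum => // j _; apply: integrableZl => //.
apply: (integrableS measurableT) => //; exact: integrable_indic_itv.
Qed.

Lemma integral_step_process (c : nat -> R) (D t : R) (k : nat) : 0 < D ->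
  k%:R * D <= t < k.+1%:R * D ->
  \int[mu]_(s in `[0, t]) c (Num.truncn (s / D)) =
    \sum_(j < k) D * c j + (t - k%:R * D) * c k.
Proof.
move=> D0 /andP[kt tk].
have iF r := step_process_integrable c r D0.
have kD0 (j : nat) : 0 <= j%:R * D by rewrite mulr_ge0// ltW.
rewrite (@integral_append_constant _ (c k) (k%:R * D))//; last first.
  move=> s /=; rewrite in_itv/= => /andP[ks st].
  by rewrite (truncn_divE D0 (j := k))// ks (le_lt_trans st tk).
congr (_ + _); elim: k {kt tk} => [|k IH].
  by rewrite big_ord0 mul0r set_itvco0 Rintegral_set0.
rewrite (@integral_append_constant _ (c k) (k%:R * D))//.
- by rewrite IH big_ord_recr/= -mulrBl -natrB// subSnn mul1r.
- by rewrite ler_pM2r// ler_nat.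
- by move=> s /=; rewrite in_itv/= => ks; rewrite (truncn_divE D0 ks).
- apply: (integrableS _ _ _ (iF (k.+1%:R * D))) => // s /=.
  by rewrite !in_itv/= => /andP[-> /ltW].
Qed.

(** Within a cell both integrals reduce to the sums defining the grid value plus
    one term in the time and noise elapsed since the last grid point. *)
Lemma em_cont_grid (Omega : Type) (W : R -> Omega -> R) (a b : R -> R)
    (y0 D t : R) (k : nat) (w : Omega) : 0 < D ->
    k%:R * D <= t < k.+1%:R * D ->
  em_cont W a b y0 D t w =
    em_grid W a b y0 D k w + (t - k%:R * D) * a (em_grid W a b y0 D k w)
    + b (em_grid W a b y0 D k w) * (W t w - W (k%:R * D) w).
Proof.
move=> D0 ktk; have [kt tk] := andP ktk.
rewrite /em_cont /elementary_ito /em_step.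
rewrite (integral_step_process (fun j => a (em_grid W a b y0 D j w)) D0 ktk).
rewrite (truncn_divE D0 ktk) big_ord_recr/= (min_r (ltW tk)) (min_l kt).
under [\sum_(i < k) b _ * _]eq_bigr => j _.
  have jt (i : nat) : (i <= k)%N -> i%:R * D <= t.
    by move=> ik; apply: le_trans kt; rewrite ler_pM2r// ler_nat.
  rewrite !min_l ?jt//; last exact: ltnW.
  over.
rewrite /=.
have -> : em_grid W a b y0 D k w = y0 +
  \sum_(j < k) D * a (em_grid W a b y0 D j w) +
  \sum_(j < k) b (em_grid W a b y0 D j w) *
    (W (j.+1%:R * D) w - W (j%:R * D) w).
  elim: (k) => [|n IH]; first by rewrite !big_ord0 !addr0.
  by rewrite !big_ord_recr/= {1}IH; ring.
ring.
Qed.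

End step_process.

(** * Measurability and conditional expectation over one step *)

Lemma locally_lipschitz_continuous (R : realType) (f : R -> R) :
  locally_lipschitz f -> continuous f.
Proof.
move=> lf x; have r0 : 0 < `|x| + 1 by rewrite ltr_wpDl.
have [M [_ Mlip]] := lf _ r0.
have /= lip := Mlip (`|M| + 1) (ltr_pwDr ltr01 (ler_norm M)).
have k0 : 0 < `|M| + 1 by rewrite ltr_wpDl.
apply/cvgrPdist_le => /= e e0; near=> y.
have xy1 : `|x - y| <= 1 by near: y; apply: cvgr_dist_le => //.
have := lip (x, y); rewrite /= !in_itv/= => le.
apply: (le_trans (le _)).
  split; rewrite -ler_norml; first by rewrite lerDl.
  rewrite (le_trans _ (lerD (lexx _) xy1))//.
  by rewrite -{1}(subKr x y) (le_trans (ler_normB _ _)).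
rewrite mulrC -ler_pdivlMr//; near: y; apply: cvgr_dist_le => //.
by rewrite divr_gt0.
Unshelve. all: by end_near. Qed.

Lemma measurable_clip (R : realType) (r : R) : 0 <= r ->
  measurable_fun [set: R] (clip r).
Proof.
move=> r0; rewrite (_ : clip r = fun x => Num.max (- r) (Num.min x r)).
  by apply: measurable_maxr => //; exact: measurable_minr.
by apply/funext => x; rewrite clipE.
Qed.

Lemma measurable_truncated (R : realType) (psi_inv h f : R -> R) (D : R) :
  0 <= psi_inv (h D) -> locally_lipschitz f ->
  measurable_fun [set: R] (truncated psi_inv h D f).
Proof.
move=> r0 lf; apply: measurableT_comp; last exact: measurable_clip.
exact: (continuous_measurable_fun (locally_lipschitz_continuous lf)).
Qed.

(** The sigma-algebra on [T] is arbitrary: applied to the one generated by the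
    increments preceding a grid point, this says that the scheme is adapted. *)
Lemma measurable_em_grid (R : realType) (d : measure_display)
    (T : measurableType d) (W : R -> T -> R) (a b : R -> R) (y0 D : R)
    (k : nat) :
    measurable_fun setT a -> measurable_fun setT b ->
    (forall j, (j < k)%N -> measurable_fun setT
      (fun w => W (j.+1%:R * D) w - W (j%:R * D) w)) ->
  measurable_fun setT (em_grid W a b y0 D k).
Proof.
move=> ma mb; elim: k => [_|k IH mW]; first exact: measurable_cst.
have mk : measurable_fun setT (em_grid W a b y0 D k).
  by apply: IH => j jk; apply: mW; exact: ltnW.
apply: measurable_funD; last first.
  by apply: measurable_funM; [exact: measurableT_comp|exact: mW].
apply: measurable_funD => //; apply: measurable_funM => //.
exact: measurableT_comp.
Qed.

(** Integrating out the Gaussian variable first leaves the moment generating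
    function, to which the pointwise hypothesis applies. *)
Lemma gaussian_step (R : realType) (d : measure_display)
    (Omega : measurableType d) (P : probability Omega R)
    (X Z : Omega -> R) (a b : R -> R) (p c s : R) :
    measurable_fun setT X -> measurable_fun setT Z ->
    measurable_fun setT a -> measurable_fun setT b -> 0 < s ->
    (forall A B, measurable A -> measurable B ->
      P (X @^-1` A `&` Z @^-1` B) =
      P (X @^-1` A) * normal_prob 0 (Num.sqrt s) B)%E ->
    (forall x, expR (p * (x + s * a x) + p ^+ 2 * b x ^+ 2 * s / 2) + 1
               <= expR c * (expR (p * x) + 1)) ->
  (\int[P]_w (expR (p * (X w + s * a (X w) + b (X w) * Z w)) + 1)%:E
    <= (expR c)%:E * \int[P]_w (expR (p * X w) + 1)%:E)%E.
Proof.
move=> mX mZ ma mb s0 indXZ step.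
have mexp d' (T : measurableType d') (F : T -> R) : measurable_fun setT F ->
    measurable_fun setT (fun w => (expR (p * F w) + 1)%:E).
  move=> mF; apply/measurable_EFinP; apply: measurable_funD => //.
  apply: measurableT_comp => //; exact: measurable_funM.
have e0 (x : R) : (0 <= (expR x + 1)%:E)%E.
  by rewrite lee_fin addr_ge0// expR_ge0.
rewrite -ge0_integralZl//; last exact: mexp.
pose Q : probability (measurableTypeR R) R := normal_prob 0 (Num.sqrt s).
pose F (v : R * measurableTypeR R) := (expR (p * (v.1 + s * a v.1 + b v.1 * v.2)) + 1)%:E.
have mF : measurable_fun setT F.
  apply: mexp; apply: measurable_funD.
    apply: measurable_funD => //; apply: measurable_funM => //.
    by apply: measurableT_comp.
  by apply: measurable_funM => //; apply: measurableT_comp.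
rewrite (@integral_independent _ _ _ _ R (measurableTypeR R) R P Q X Z F mX mZ)
  //; last by move=> v; exact: e0.
have sq0 : Num.sqrt s != 0 by rewrite gt_eqF// sqrtr_gt0.
apply: ge0_le_integral => //.
- by move=> w _; apply: integral_ge0 => z _; exact: e0.
- have mG : measurable_fun setT
      (fubini_F (normal_prob 0 (Num.sqrt s)) F : R -> \bar R).
    by apply: measurable_fun_fubini_tonelli_F => // v; exact: e0.
  exact: (measurableT_comp mG mX).
- by apply: emeasurable_funM => //; exact: mexp.
- move=> w _; rewrite /F /=; set x := X w.
  under eq_integral => z _ do rewrite [p * _]mulrDr [p * (_ * z)]mulrA.
  rewrite normal_affine_mgf// sqr_sqrtr ?(ltW s0)// exprMn -EFinM lee_fin.
  exact: step.
Qed.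

(** * Exponential moments along the scheme *)

(** Apply [independent_others] to the increments along the grid up to [k * D]
    followed by the increment up to [t]. *)
Lemma em_grid_independent (R : realType) (d : measure_display)
    (Omega : measurableType d) (P : probability Omega R)
    (W : R -> {RV P >-> R}) (a b : R -> R) (y0 D t : R) (k : nat)
    (A B : set R) :
    brownian_motion W -> measurable_fun setT a -> measurable_fun setT b ->
    0 < D -> k%:R * D < t -> measurable A -> measurable B ->
  (P (em_grid (fun s => W s) a b y0 D k @^-1` A
      `&` (fun w => W t w - W (k%:R * D)%R w)%R @^-1` B) =
   P (em_grid (fun s => W s) a b y0 D k @^-1` A) *
   normal_prob 0 (Num.sqrt (t - k%:R * D)) B)%E.
Proof.
move=> bm ma mb D0 kt mA mB.
have kD0 (j : nat) : 0 <= j%:R * D by rewrite mulr_ge0// ltW.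
(* indices [0], ..., [k] run over the grid, index [k + 1] is the time [t] *)
pose tau (i : nat) := if (i <= k)%N then i%:R * D else t.
have tau_lt i : (i < k.+1)%N -> tau i < tau i.+1.
  rewrite ltnS /tau => ik; rewrite ik; case: ifPn => [_|].
    by rewrite ltr_pM2r// ltr_nat.
  rewrite -ltnNge ltnS => ki.
  by have -> : i = k by apply/eqP; rewrite eqn_leq ik.
pose X (i : 'I_k.+1) (w : Omega) := W (tau i.+1) w - W (tau i) w.
have indX : mutually_independent P X.
  by apply: (bm_independent bm) => //; rewrite /tau leq0n.
have mX i : measurable_fun setT (X i).
  by apply: measurable_funB; exact: measurable_funPT.
have Xlast : X ord_max = (fun w => W t w - W (k%:R * D) w).
  by apply/funext => w; rewrite /X /tau /= ltnn leqnn.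
pose G := g_sigma_algebraType (others_events X ord_max).
have mgrid : measurable_fun [set: G] (em_grid (fun s => W s) a b y0 D k).
  apply: (@measurable_em_grid _ _ G) => // j jk.
  have jS : (j < k.+1)%N by exact: ltnW.
  rewrite (_ : (fun w => _) = X (Ordinal jS)).
    by apply: others_measurable; rewrite -val_eqE/= neq_ltn jk.
  by apply/funext => w; rewrite /X /tau /= jk (ltnW jk).
rewrite -(bm_gaussian bm (kD0 k) kt mB) -Xlast.
apply: independent_others => //.
by have := mgrid measurableT _ mA; rewrite setTI.
Qed.

Section moments.
Variables (R : realType) (d : measure_display) (Omega : measurableType d).
Variables (P : probability Omega R) (W : R -> {RV P >-> R}).
Hypothesis bm : brownian_motion W.
Variables (a b : R -> R) (y0 p C D : R).
Hypotheses (ma : measurable_fun setT a) (mb : measurable_fun setT b).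
Hypothesis D0 : 0 < D.
Hypothesis step : forall s x, 0 <= s <= D ->
  expR (p * (x + s * a x) + p ^+ 2 * b x ^+ 2 * s / 2) + 1
    <= expR (C * s) * (expR (p * x) + 1).

Let grid := em_grid (fun s => W s) a b y0 D.
Let cont := em_cont (fun s => W s) a b y0 D.

Lemma measurable_grid k : measurable_fun setT (grid k).
Proof.
apply: measurable_em_grid => // j _.
by apply: measurable_funB; exact: measurable_funPT.
Qed.

Lemma em_increment_moment (k : nat) (t : R) :
    k%:R * D <= t <= k.+1%:R * D ->
  (\int[P]_w (expR (p * (grid k w + (t - k%:R * D) * a (grid k w)
                 + b (grid k w) * (W t w - W (k%:R * D) w))) + 1)%:E
    <= (expR (C * (t - k%:R * D)))%:E *
      \int[P]_w (expR (p * grid k w) + 1)%:E)%E.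
Proof.
move=> /andP[kt tk]; have [->|tkD] := eqVneq t (k%:R * D).
  rewrite subrr mulr0 expR0 mul1e.
  by under eq_integral do rewrite subrr mul0r mulr0 !addr0.
have kt' : k%:R * D < t by rewrite lt_neqAle eq_sym tkD.
apply: gaussian_step => //.
- exact: measurable_grid.
- by apply: measurable_funB; exact: measurable_funPT.
- by rewrite subr_gt0.
- by move=> A B mA mB; exact: em_grid_independent.
- move=> x; apply: step; rewrite subr_ge0 kt/=.
  by rewrite lerBlDr (le_trans tk)// -natr1 mulrDl mul1r addrC.
Qed.

(** The factors [expR (C * D)] of the successive steps multiply, and [k * D] is
    the elapsed time. *)
Lemma em_grid_moment (k : nat) :
  (\int[P]_w (expR (p * grid k w) + 1)%:E
    <= (expR (C * (k%:R * D)) * (expR (p * y0) + 1))%:E)%E.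
Proof.
elim: k => [|k IH].
  rewrite mul0r mulr0 expR0 mul1r /grid /= integral_cst//=.
  by rewrite probability_setT mule1.
have kD : k.+1%:R * D - k%:R * D = D by rewrite -natr1; ring.
have := @em_increment_moment k (k.+1%:R * D).
rewrite kD lexx andbT ler_pM2r// ler_nat leqnSn => /(_ isT) h.
apply: (le_trans h); rewrite -natr1 mulrDl mul1r mulrDr addrC expRD -mulrA.
by rewrite EFinM lee_wpmul2l// lee_fin expR_ge0.
Qed.

Lemma em_cont_increment (t : R) : 0 <= t -> exists k : nat,
  [/\ k%:R * D <= t <= k.+1%:R * D, measurable_fun setT (cont t) &
      cont t = fun w => grid k w + (t - k%:R * D) * a (grid k w)
                 + b (grid k w) * (W t w - W (k%:R * D) w)].
Proof.
move=> t0; have /truncn_itv := divr_ge0 t0 (ltW D0).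
set k := Num.truncn _; rewrite ler_pdivlMr// ltr_pdivrMr// => ktk.
have contE : cont t = fun w => grid k w + (t - k%:R * D) * a (grid k w)
    + b (grid k w) * (W t w - W (k%:R * D) w).
  by apply/funext => w; exact: em_cont_grid.
have mk := measurable_grid k.
exists k; split=> //; first by have /andP[-> /ltW] := ktk.
rewrite contE; apply: measurable_funD.
  by apply: measurable_funD => //; apply: measurable_funM => //;
    exact: measurableT_comp.
apply: measurable_funM; first exact: measurableT_comp.
by apply: measurable_funB; exact: measurable_funPT.
Qed.

Lemma em_cont_moment (t : R) : 0 <= t ->
  (\int[P]_w (expR (p * cont t w) + 1)%:E
    <= (expR (C * t) * (expR (p * y0) + 1))%:E)%E.
Proof.
move=> /em_cont_increment[k [ktk _ ->]].
apply: (le_trans (em_increment_moment ktk)).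
rewrite (_ : C * t = C * (t - k%:R * D) + C * (k%:R * D)); last by ring.
rewrite expRD -mulrA EFinM lee_wpmul2l ?lee_fin ?expR_ge0//.
exact: em_grid_moment.
Qed.

End moments.

Lemma truncated_em_moment (R : realType) (d : measure_display)
    (Omega : measurableType d) (P : probability Omega R)
    (W : R -> {RV P >-> R}) (f g psi psi_inv h : R -> R)
    (c0 p K1 y0 D t : R) :
    brownian_motion W -> locally_lipschitz f -> locally_lipschitz g ->
    truncation f g psi psi_inv h c0 -> 2 <= p -> 0 <= K1 ->
    (forall y, expR (2 * y) * (f y + p / 2 * g y ^+ 2)
               <= K1 * (1 + expR (2 * y))) ->
    0 < D <= 1 -> 0 <= t ->
  measurable_fun setT (truncated_em (fun s => W s) f g psi_inv h y0 D t) /\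
  (\int[P]_w (expR (p * truncated_em (fun s => W s) f g psi_inv h y0 D t w)
              + 1)%:E
    <= (expR (growth_rate p c0 K1 * t) * (expR (p * y0) + 1))%:E)%E.
Proof.
move=> bm lf lg tr p2 K0 drift D01 t0; have [D0 _] := andP D01.
have r0 : 0 <= psi_inv (h D).
  by rewrite (le_trans _ (tr_psi_inv_ge1 tr (tr_h_ge tr D01))).
have mtr k : locally_lipschitz k ->
    measurable_fun setT (truncated psi_inv h D k).
  exact: measurable_truncated.
have mf := mtr _ lf; have mg := mtr _ lg.
split; last first.
  apply: em_cont_moment => // s x sD.
  exact: (truncated_exponential_step _ tr p2 K0 drift).
by have [k []] := em_cont_increment W y0 mf mg D0 t0.
Qed.

Theorem theorem4p17 (R : realType) (d : measure_display)
    (Omega : measurableType d) (P : probability Omega R)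
    (W : R -> {RV P >-> R}) (T y0 : R)
    (f g psi psi_inv h : R -> R) (c0 : R)
    (hT : 0 < T)
    (hW : brownian_motion W)
    (hf : locally_lipschitz f) (hg : locally_lipschitz g)
    (htr : truncation f g psi psi_inv h c0)
    (hK : forall p : R, 0 < p -> exists K K1 : R,
      [/\ 0 < K, 0 < K1,
          forall y : R, y * f y + (p - 1) / 2 * g y ^+ 2 <= K &
          forall y : R, expR (2 * y) * (f y + p / 2 * g y ^+ 2)
                          <= K1 * (1 + expR (2 * y))]) :
  forall p : R, 0 < p ->
    (ereal_sup [set ereal_sup
        [set 'E_P[fun w => expR (p * truncated_em (fun s => W s)
                                       f g psi_inv h y0 D t w)]
          | t in `[0%R, T]%classic]
      | D in step_sizes T] < +oo)%E.
Proof.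
(* the one-step inequality needs an exponent at least [2] *)
move=> p p0; pose q := Num.max p 2.
have q2 : 2 <= q by rewrite le_max lexx orbT.
have pq : p <= q by rewrite le_max lexx.
have [_ [K1 [_ K10 _ drift]]] := hK _ (lt_le_trans p0 pq).
pose C := growth_rate q c0 K1.
have C0 : 0 <= C.
  by rewrite /C /growth_rate !mulr_ge0// ?expR_ge0// ltW// (lt_le_trans p0).
apply: (@le_lt_trans _ _ (expR (C * T) * (expR (q * y0) + 1))%:E); last first.
  exact: ltry.
apply: ub_ereal_sup => _ [D [D1 [N N0 DN]] <-].
have D01 : 0 < D <= 1 by rewrite D1 DN divr_gt0// ltr0n.
apply: ub_ereal_sup => _ [t /= + <-]; rewrite in_itv/= => /andP[t0 tT].
have [mY mom] := truncated_em_moment y0 hW hf hg htr q2 (ltW K10) drift D01 t0.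
have mexp r : measurable_fun setT (fun w : Omega =>
    expR (r * truncated_em (fun s => W s) f g psi_inv h y0 D t w)).
  by apply: measurableT_comp => //; exact: measurable_funM.
rewrite unlock; apply: (@le_trans _ _ (\int[P]_w
    (expR (q * truncated_em (fun s => W s) f g psi_inv h y0 D t w) + 1)%:E)%E).
  apply: ge0_le_integral => //.
  - exact/measurable_EFinP.
  - by apply/measurable_EFinP; exact: measurable_funD.
  - move=> w _; rewrite lee_fin; set Y := truncated_em _ _ _ _ _ _ _ _ _.
    have [Y0|Y0] := leP 0 Y.
      by rewrite (@le_trans _ _ (expR (q * Y)))// ?lerDl// ler_expR ler_wpM2r.
    rewrite (@le_trans _ _ 1)// ?lerDr ?expR_ge0// expR_le1.
    by rewrite pmulr_rle0// ltW.
apply: (le_trans mom); rewrite lee_fin.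
by rewrite ler_wpM2r ?addr_ge0 ?expR_ge0// ler_expR ler_wpM2l.
Qed.
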